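(* For every $\alpha\in(0,1]$, there exist an instance with a finite set of agents, a finite set $\mathcal{M}$ of goods, and two additive valuation functions $u,v:2^{\mathcal{M}}\to\mathbb{R}_{\ge0}$, giving two identical valuation profiles (in the first profile every agent has valuation $u$, in the second profile every agent has valuation $v$; either profile can be viewed as consisting of identical subjective utilities and the other as market values), such that no allocation is simultaneously EF1 with respect to the first profile and $\alpha$-EFX with respect to the second profile.
   Context: A function $f:2^{\mathcal{M}}\to\mathbb{R}_{\ge0}$ is additive if $f(S)=\sum_{g\in S}f(\{g\})$ for all $S\subseteq\mathcal{M}$, with $f(\emptyset)=0$. With $n$ agents, an allocation $A=(A_1,\dots,A_n)$ is a partition of $\mathcal{M}$ into $n$ pairwise disjoint (possibly empty) bundles with union $\mathcal{M}$, where $A_i$ is given to agent $i$. An identical valuation profile is one in which all agents have the same valuation function $f$ (different profiles may have different functions). With respect to the identical profile with valuation $f$: $A$ is EF1 if for every pair of agents $i,j$, either $A_j=\emptyset$ or $f(A_i)\ge f(A_j\setminus\{g\})$ for some $g\in A_j$; for $\alpha\in[0,1]$, $A$ is $\alpha$-EFX if for every pair of agents $i,j$, either $A_j=\emptyset$ or $f(A_i)\ge\alpha\cdot f(A_j\setminus\{g\})$ for every $g\in A_j$. *)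

(* Defs.v *)
(* MathComp world; realType is the library's axiomatization of the real line. *)
From HB Require Import structures.
From mathcomp Require Import all_boot all_order all_algebra.
From mathcomp Require Import reals.
Set Implicit Arguments.
Unset Strict Implicit.
Unset Printing Implicit Defensive.
Import Order.TTheory GRing.Theory Num.Theory.
Local Open Scope ring_scope.

Definition additive_valuation (R : realType) (M : finType)
    (f : {set M} -> R) : Prop :=
  [/\ forall S : {set M}, 0 <= f S,
      f set0 = 0 &
      forall S : {set M}, f S = \sum_(g in S) f [set g]].

(* [partition] from finset excludes empty blocks and forgets which agent owns
   which block, so allocations are indexed families, with empty bundles
   allowed. *)
Definition is_allocation (n : nat) (M : finType)
    (A : 'I_n -> {set M}) : Prop :=
  (forall i j : 'I_n, i != j -> [disjoint A i & A j]) /\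
  \bigcup_(i < n) A i = [set: M].

(* In both fairness notions every agent has the same valuation [f]. *)
Definition EF1 (R : realType) (n : nat) (M : finType)
    (f : {set M} -> R) (A : 'I_n -> {set M}) : Prop :=
  forall i j : 'I_n,
    A j = set0 \/ exists2 g : M, g \in A j & f (A i) >= f (A j :\ g).

Definition EFX (R : realType) (n : nat) (M : finType) (alpha : R)
    (f : {set M} -> R) (A : 'I_n -> {set M}) : Prop :=
  forall i j : 'I_n,
    A j = set0 \/ forall g : M, g \in A j -> f (A i) >= alpha * f (A j :\ g).

(* Main.v *)
(* Two agents and three goods: v is concentrated on the single good None,
   while u gives weight 1 to the two other goods and 0 to None.  In an
   alpha-EFX allocation for v the agent holding None can hold nothing else,
   since the other agent's v-value is 0.  The other agent then holds both
   remaining goods, which the first agent envies by u even after one removal. *)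
Require Import Defs.
From HB Require Import structures.
From mathcomp Require Import all_boot all_order all_algebra.
From mathcomp Require Import reals.
Set Implicit Arguments.
Unset Strict Implicit.
Unset Printing Implicit Defensive.
Import Order.TTheory GRing.Theory Num.Theory.
Local Open Scope ring_scope.

Lemma additive_valuation_sum (R : realType) (M : finType) (w : M -> R) :
  (forall g, 0 <= w g) ->
  additive_valuation (fun S : {set M} => \sum_(g in S) w g).
Proof.
move=> w_ge0; split=> [S||S]; first exact: sumr_ge0.
  by rewrite big_set0.
by apply: eq_bigr => g _; rewrite big_set1.
Qed.

Lemma ler_sum_mem (R : realType) (M : finType) (w : M -> R) (S : {set M}) g :
  (forall h, 0 <= w h) -> g \in S -> w g <= \sum_(h in S) w h.
Proof.
by move=> w_ge0 gS; rewrite (bigD1 g) //= lerDl; apply: sumr_ge0.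
Qed.

Theorem theorem7 (R : realType) (alpha : R)
    (alpha_gt0 : 0 < alpha) (alpha_le1 : alpha <= 1) :
  exists (n : nat) (M : finType) (u v : {set M} -> R),
    [/\ (0 < n)%N,
        additive_valuation u,
        additive_valuation v &
        ~ exists A : 'I_n -> {set M},
            [/\ is_allocation A, EF1 u A & EFX alpha v A]].
Proof.
pose wu (g : option bool) : R := (g != None)%:R.
pose wv (g : option bool) : R := (g == None)%:R.
have wu_ge0 g : 0 <= wu g by apply: ler0n.
have wv_ge0 g : 0 <= wv g by apply: ler0n.
exists 2, (option bool), (fun S : {set _} => \sum_(g in S) wu g),
  (fun S : {set _} => \sum_(g in S) wv g).
split=> //; try exact: additive_valuation_sum.
case=> A [[disjA coverA] ef1 efx].
have owner g : exists i, g \in A i.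
  have: g \in \bigcup_(i < 2) A i by rewrite coverA inE.
  by case/bigcupP=> i _ gi; exists i.
have [i Ni] := owner None.
have notin j g : j != i -> g \in A i -> g \notin A j.
  by move=> ji gi; rewrite (disjointFl (disjA _ _ ji) gi).
have [j ji] : exists j : 'I_2, j != i.
  (* On two agents, [rev_ord] swaps them. *)
  by exists (rev_ord i); case: i {Ni notin} => [[|[]]].
have Ai g : g \in A i -> g = None.
  move=> gi; apply/eqP; apply: contraT => gN.
  have [Ai0|/(_ g gi)] := efx j i; first by rewrite Ai0 inE in Ni.
  (* [wv] vanishes on [A j], since [None] lies in the disjoint bundle [A i]. *)
  rewrite [X in _ <= X]big1 => [|h hj]; last first.
    by rewrite /wv; case: eqP hj => // ->; rewrite (negPf (notin _ _ ji Ni)).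
  have NAi : None \in A i :\ g by rewrite !inE eq_sym gN.
  (* As [alpha] is positive it cancels, leaving a nonpositive sum that contains the weight 1 of
     [None]. *)
  rewrite pmulr_rle0 // => le0.
  have := le_trans (ler_sum_mem wv_ge0 NAi) le0.
  by rewrite /wv eqxx ler10.
have Aj b : Some b \in A j.
  have [k bk] := owner (Some b).
  suff -> : j = k by [].
  have ki : k != i by apply/eqP => ki; move: bk; rewrite ki => /Ai.
  (* Among two agents, [j] and [k] both differ from [i], hence coincide. *)
  apply/val_inj; move: ji ki; clear.
  by case: i j k => [[|[]]] // ? [[|[]]] // ? [[|[]]].
have [Aj0|[g gj]] := ef1 i j; first by have := Aj true; rewrite Aj0 inE.
rewrite [X in _ <= X]big1 => [|h /Ai ->]; last by rewrite /wu eqxx.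
(* Whichever good [g] is removed, one of [wu]-weight 1 survives; for [g = None] either choice of [b]
   works. *)
have [b bg] : exists b, Some b != g.
  by case: g {gj} => [c|]; [exists (~~ c); case: c | exists true].
have bAj : Some b \in A j :\ g by rewrite !inE bg Aj.
move=> le0; have := le_trans (ler_sum_mem wu_ge0 bAj) le0.
by rewrite /wu /= ler10.
Qed.
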